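(* Let $\psi\in\Psi_d$ be regularly varying at infinity with index $-1/\theta$ for some $\theta>0$, and let $C$ be the $d$-dimensional Archimedean copula generated by $\psi$. For $\boldsymbol{t}\in(0,1]^d$ with $C(\boldsymbol{t})>0$ let $C_{\boldsymbol{t}}$ be the copula of $C$ right-truncated at $\boldsymbol{t}$. Then, as $\boldsymbol{t}\downarrow\boldsymbol{0}$ in the sense that $t_j\downarrow0$ for at least one $j\in\{1,\dots,d\}$, $C_{\boldsymbol{t}}$ converges (pointwise) to the Clayton copula with parameter $\theta$, that is, to the $d$-dimensional Archimedean copula with generator $t\mapsto(1+t)^{-1/\theta}$.
   Context: For $\boldsymbol{U}\sim C$ ($C$ a $d$-dimensional copula) and $\boldsymbol{t}\in(0,1]^d$ with $C(\boldsymbol{t})>0$, the right-truncated copula $C_{\boldsymbol{t}}$ is the (unique) copula of the conditional distribution of $\boldsymbol{U}$ given $\boldsymbol{U}\le\boldsymbol{t}$ (componentwise). An Archimedean generator is a continuous, non-increasing function $\psi:[0,\infty)\to[0,1]$ with $\psi(0)=1$, $\lim_{t\to\infty}\psi(t)=0$, strictly decreasing on $[0,\inf\{t:\psi(t)=0\})$; $\psi^{-1}$ denotes its inverse on $(0,1]$, with $\psi^{-1}[0]=\inf\{t:\psi(t)=0\}$ (equal to $\infty$ if $\psi>0$ everywhere) and $\psi(\infty)=0$. A copula $C$ is Archimedean with generator $\psi$ if $C(\boldsymbol{u})=\psi(\psi^{-1}[u_1]+\dots+\psi^{-1}[u_d])$; $\Psi_d$ is the set of all generators which generate a $d$-dimensional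 Archimedean copula. $\psi$ is regularly varying at infinity with index $-1/\theta$ if $\lim_{t\to\infty}\psi(xt)/\psi(t)=x^{-1/\theta}$ for all $x>0$. *)

(* Defs.v *)
From HB Require Import structures.
From mathcomp Require Import all_boot all_order all_algebra.
From mathcomp Require Import all_classical all_reals all_analysis.

Set Implicit Arguments.
Unset Strict Implicit.
Unset Printing Implicit Defensive.

Import Order.TTheory GRing.Theory Num.Theory.
Import numFieldNormedType.Exports.

Local Open Scope classical_set_scope.
Local Open Scope ring_scope.

(* A d-dimensional copula is a function ('I_d -> R) -> R of which only the
   values on the unit cube [0,1]^d are meaningful. *)
Definition unit_cube (R : realType) (d : nat) : set ('I_d -> R) :=
  [set u | forall j, 0 <= u j <= 1].

(* The event {U <= x}, componentwise. *)
Definition below (R : realType) (d : nat) (disp : measure_display)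
    (T : measurableType disp) (P : probability T R)
    (U : 'I_d -> {RV P >-> R}) (x : 'I_d -> R) : set T :=
  [set w | forall j, U j w <= x j].

Definition cond_prob (R : realType) (disp : measure_display)
    (T : measurableType disp) (P : probability T R) (A B : set T) : R :=
  fine (P (A `&` B)) / fine (P B).

(* U ~ C: the joint distribution function of U is C, and each U_j is uniform
   on [0,1]. *)
Definition has_copula_law (R : realType) (d : nat) (disp : measure_display)
    (T : measurableType disp) (P : probability T R)
    (U : 'I_d -> {RV P >-> R}) (C : ('I_d -> R) -> R) : Prop :=
  (forall j x, 0 <= x <= 1 -> cdf (U j) x = x%:E) /\
  (forall u, unit_cube u -> P (below U u) = (C u)%:E).

(* A copula is the restriction to the unit cube of a joint distribution
   function with standard uniform margins. *)
Definition is_copula (R : realType) (d : nat) (C : ('I_d -> R) -> R) : Prop :=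
  exists (disp : measure_display) (T : measurableType disp)
         (P : probability T R) (U : 'I_d -> {RV P >-> R}),
    has_copula_law U C.

(* K is a copula of the conditional distribution of U given the event B, in the
   sense of Sklar's theorem: the conditional joint distribution function at x
   is K evaluated at the conditional marginal distribution functions. *)
Definition is_copula_given (R : realType) (d : nat) (disp : measure_display)
    (T : measurableType disp) (P : probability T R)
    (U : 'I_d -> {RV P >-> R}) (B : set T) (K : ('I_d -> R) -> R) : Prop :=
  is_copula K /\
  forall x : 'I_d -> R,
    cond_prob P (below U x) B =
    K (fun j => cond_prob P [set w | U j w <= x j] B).

Definition is_right_truncated_copula (R : realType) (d : nat)
    (C : ('I_d -> R) -> R) (t : 'I_d -> R) (K : ('I_d -> R) -> R) : Prop :=
  exists (disp : measure_display) (T : measurableType disp)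
         (P : probability T R) (U : 'I_d -> {RV P >-> R}),
    has_copula_law U C /\ is_copula_given U (below U t) K.

(* The function C_t.  When C is a copula, t is in (0,1]^d and C t > 0, its
   values on the unit cube do not depend on the choice made by xget: the law of
   U is determined by C and the conditional margins are continuous, so the
   copula is unique.  The default value 0 is only used if no such copula
   exists. *)
Definition right_truncated_copula (R : realType) (d : nat)
    (C : ('I_d -> R) -> R) (t : 'I_d -> R) : ('I_d -> R) -> R :=
  xget (fun=> 0) [set K | is_right_truncated_copula C t K].

(* For u in (0,1] and psi an Archimedean generator the set below is the
   singleton {psi^{-1}[u]}; for u = 0 it is the zero set of psi on [0,+oo[, and
   the infimum is +oo when psi has no zero. *)
Definition generator_inv (R : realType) (psi : R -> R) (u : R) : \bar R :=
  ereal_inf [set x%:E | x in [set x : R | 0 <= x /\ psi x = u]].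

(* psi extended by psi(+oo) = 0 (the value at -oo is irrelevant). *)
Definition generator_ext (R : realType) (psi : R -> R) (x : \bar R) : R :=
  if x is r%:E then psi r else 0.

Definition archimedean_generator (R : realType) (psi : R -> R) : Prop :=
  {within `[0, +oo[, continuous psi} /\
  (forall x, 0 <= x -> 0 <= psi x <= 1) /\
  (forall x y, 0 <= x -> x <= y -> psi y <= psi x) /\
  psi 0 = 1 /\
  psi x @[x --> +oo] --> (0 : R) /\
  (forall x y, 0 <= x -> x < y -> (y%:E < generator_inv psi 0)%E ->
     psi y < psi x).

Definition archimedean (R : realType) (d : nat) (psi : R -> R)
    (u : 'I_d -> R) : R :=
  generator_ext psi (\sum_(j < d) generator_inv psi (u j))%E.

(* Psi_d *)
Definition generators (R : realType) (d : nat) : set (R -> R) :=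
  [set psi | archimedean_generator psi /\ is_copula (@archimedean R d psi)].

Definition regularly_varying (R : realType) (psi : R -> R) (rho : R) : Prop :=
  forall x, 0 < x -> psi (x * t) / psi t @[t --> +oo] --> x `^ rho.

Definition clayton_generator (R : realType) (theta : R) (t : R) : R :=
  (1 + t) `^ (- theta^-1).

(* Main.v *)
Require Import Defs.
From HB Require Import structures.
From mathcomp Require Import all_boot all_order all_algebra.
From mathcomp Require Import all_classical all_reals all_analysis.
From mathcomp Require Import measurable_realfun.

Set Implicit Arguments.
Unset Strict Implicit.
Unset Printing Implicit Defensive.

Import Order.TTheory GRing.Theory Num.Theory.
Import numFieldNormedType.Exports.

Local Open Scope classical_set_scope.
Local Open Scope ring_scope.

(** Conditioning [U ~ C] on [U <= t] replaces an Archimedean copula by another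
    one.  Write [s] for the sum of the [psi^{-1}[t_j]], so that [C t = psi s].
    The conditional [j]-th margin at [x <= t_j] is
    [psi (psi^{-1}[x] + s - psi^{-1}[t_j]) / psi s]; solving for the quantiles
    [y_j] of levels [u_j] and evaluating [C y / C t] shows that [C_t] is
    Archimedean with generator [x |-> psi (s + x) / psi s].  Rescaling the
    argument of a generator does not change its copula, so
    [x |-> psi ((1 + x) s) / psi s] is a generator of [C_t] as well
    ([right_truncated_archimedean]).  Regular variation of [psi] says exactly
    that this rescaled generator converges pointwise to the Clayton generator
    [(1 + x)^(-1/theta)] as [s] tends to infinity, and [s] does so as soon as
    one [t_j] tends to [0] ([sum_generator_inv_cvgy]).  Finally, pointwise
    convergence of generators implies pointwise convergence of the copulas,
    because monotonicity turns it into convergence of the inverses and of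
    values at convergent arguments ([archimedean_cvg]).

    The function [C_t] is given by a choice among the copulas of the conditional
    law.  Such a copula exists: the law of the probability integral transforms
    of the [U_j] under the conditional probability is one
    ([sklar_onto_margins]).  Its values on the unit cube are forced, since every
    level [u_j] is attained by the [j]-th conditional margin
    ([right_truncated_copulaE]). *)

(** * Conditional laws and Sklar's theorem for margins onto [0,1] *)

Section conditional_law.
Context (R : realType) (disp : measure_display) (T : measurableType disp).
Implicit Types (P : probability T R) (A B : set T).

Lemma measurable_le_rv P (X : {RV P >-> R}) (x : R) :
  measurable [set w | X w <= x].
Proof.
have -> : [set w | X w <= x] = X @^-1` `]-oo, x].
  by apply/seteqP; split => w /=; rewrite in_itv.
exact: measurable_funPTI.
Qed.

Lemma measurable_below P d (U : 'I_d -> {RV P >-> R}) (x : 'I_d -> R) :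
  measurable (below U x).
Proof.
have -> : below U x = \bigcap_(j in [set: 'I_d]) [set w | U j w <= x j].
  by apply/seteqP; split => w /= Uw j; [move=> _; exact: Uw|exact: Uw].
apply: fin_bigcap_measurable; first exact: finite_finset.
by move=> j _; exact: measurable_le_rv.
Qed.

Lemma cdfE P (X : {RV P >-> R}) (x : R) : cdf X x = P [set w | X w <= x].
Proof. by congr (P _). Qed.

Lemma fine_cdf_le P (X : {RV P >-> R}) : nondecreasing (fun x => fine (cdf X x)).
Proof.
move=> x y xy; rewrite fine_le ?fin_num_measure//.
exact: cdf_nondecreasing.
Qed.

Lemma conditional_probability P B (mB : measurable B) : (0 < P B)%E ->
  exists Q : probability T R,
    forall A, measurable A -> Q A = (cond_prob P A B)%:E.
Proof.
move=> PB0; exists (mnormalize (mrestr P mB) P) => A mA.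
have finP C : measurable C -> P C = (fine (P C))%:E.
  by move=> mC; rewrite fineK// fin_num_measure.
have mAB : measurable (A `&` B) by exact: measurableI.
have PT : (mrestr P mB : {measure set T -> \bar R}) setT = P B.
  by rewrite /= /mrestr setTI.
transitivity (mrestr P mB A * ((fine (P B))^-1)%:E)%E.
  rewrite /= /mnormalize PT ifF//; apply/negbTE; rewrite negb_or.
  by rewrite gt_eqF// (finP _ mB).
by rewrite /mrestr (finP _ mAB) -EFinM.
Qed.

Lemma null_setD P A B : measurable A -> measurable B ->
  A `<=` B -> P A = P B -> P (B `\` A) = 0%E.
Proof.
move=> mA mB AB PAB; transitivity (P B - P A)%E.
  by rewrite measureD ?setIidr// ltey_eq fin_num_measure.
by rewrite PAB subee// fin_num_measure.
Qed.

(** Countable subadditivity of null sets, with the finite family padded by the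
    empty set. *)
Lemma null_finite_cover P d (A : 'I_d -> set T) B :
  (forall j, measurable (A j)) -> (forall j, P (A j) = 0%E) ->
  measurable B -> B `<=` \bigcup_j A j -> P B = 0%E.
Proof.
move=> mA A0 mB BA; apply/(negligibleP P mB).
pose A' k : set T := if insub k is Some j then A j else set0.
apply: (@negligibleS _ _ _ _ (\bigcup_k A' k)).
  by move=> w /BA[j _ Aw]; exists (val j) => //; rewrite /A' valK.
apply: negligible_bigcup => k; rewrite /A'.
case: insubP => [j _ _|_]; last exact: negligible_set0.
by apply/(negligibleP P (mA j)); exact: A0.
Qed.

(** The probability integral transform of [X], i.e. its distribution function
    evaluated at [X] itself. *)
Definition prob_transform P (X : {RV P >-> R}) : T -> R :=
  fun w => fine (cdf X (X w)).

Lemma measurable_prob_transform P (X : {RV P >-> R}) :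
  measurable_fun setT (prob_transform X).
Proof.
apply: (@measurableT_comp _ _ _ _ _ _ (fun x => fine (cdf X x))) => //.
by apply: nondecreasing_measurable => // x y xy; exact: fine_cdf_le.
Qed.

HB.instance Definition _ P (X : {RV P >-> R}) :=
  isMeasurableFun.Build _ _ _ _ (prob_transform X)
    (measurable_prob_transform X).

(** If [v] is the value of the distribution function at [x], then [X <= x]
    implies [cdf X X <= v], whence one inequality.  Conversely [cdf X X <= v]
    forces [X <= x'] for every [x'] whose value exceeds [v]; as all such values
    are attained, the other inequality follows by letting them decrease to
    [v]. *)
Lemma cdf_prob_transform P (X : {RV P >-> R}) :
  (forall v, 0 <= v <= 1 -> exists x, cdf X x = v%:E) ->
  forall v, 0 <= v <= 1 ->
    cdf (prob_transform X : {RV P >-> R}) v = v%:E.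
Proof.
move=> onto v v01.
have mV := @measurable_le_rv P (prob_transform X : {RV P >-> R}).
have := v01; move=> /andP[v0]; rewrite le_eqVlt => /predU1P[->|v1].
  rewrite cdfE (_ : [set _ | _] = setT) ?probability_setT//.
  apply/seteqP; split => // w _ /=.
  rewrite -lee_fin /prob_transform fineK ?cdf_le1//.
  by rewrite cdfE fin_num_measure//; exact: measurable_le_rv.
apply/eqP; rewrite eq_le; apply/andP; split.
- apply/lee_addgt0Pr => e e0.
  pose v' := Num.min 1 (v + e).
  have v'1 : v' <= 1 by rewrite ge_min lexx.
  have vv' : v < v' by rewrite lt_min v1 ltrDl.
  have [x' x'E] : exists x, cdf X x = v'%:E.
    by apply: onto; rewrite v'1 (le_trans v0 (ltW vv')).
  rewrite -EFinD; apply: (@le_trans _ _ v'%:E); last first.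
    by rewrite lee_fin ge_min lexx orbT.
  rewrite -x'E !cdfE le_measure ?inE//; first exact: measurable_le_rv.
  move=> w /= Vw; rewrite leNgt; apply/negP => x'X.
  have := fine_cdf_le X (ltW x'X); rewrite x'E /= => /le_trans/(_ Vw).
  by rewrite leNgt vv'.
- have [x xE] := onto _ v01.
  rewrite -xE !cdfE le_measure ?inE//; first exact: measurable_le_rv.
  move=> w /= Xw.
  by have := fine_cdf_le X Xw; rewrite xE.
Qed.

(** The copula is the joint distribution function of the probability integral
    transforms [V_j] of the [U_j].  The event [U_j <= x_j] is contained in
    [V_j <= v_j], where [v_j] is the margin at [x_j], and both have
    probability [v_j]; hence the joint events built from [U] and from [V] differ
    by a null set. *)
Lemma sklar_onto_margins P d (U : 'I_d -> {RV P >-> R}) :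
  (forall j v, 0 <= v <= 1 -> exists x, cdf (U j) x = v%:E) ->
  exists K, is_copula K /\
    forall x, P (below U x) = (K (fun j => fine (cdf (U j) (x j))))%:E.
Proof.
move=> onto.
pose V j := prob_transform (U j) : {RV P >-> R}.
have finP C : measurable C -> (fine (P C))%:E = P C.
  by move=> mC; rewrite fineK// fin_num_measure.
exists (fun v => fine (P (below V v))); split.
  exists disp, T, P, V; split => [j x|u _].
    by apply: cdf_prob_transform => v; exact: onto.
  by rewrite finP//; exact: measurable_below.
move=> x; set v := fun j => _.
rewrite finP; last exact: measurable_below.
have UV j : [set w | U j w <= x j] `<=` [set w | V j w <= v j].
  by move=> w /=; exact: fine_cdf_le.
have UVb : below U x `<=` below V v by move=> w Uw j; exact/UV/Uw.
have mU := measurable_below U x; have mV := measurable_below V v.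
have finU j y : (fine (cdf (U j) y))%:E = cdf (U j) y.
  by rewrite cdfE finP//; exact: measurable_le_rv.
have null : P (below V v `\` below U x) = 0%E.
  apply: (@null_finite_cover _ _
    (fun j => [set w | V j w <= v j] `\` [set w | U j w <= x j])).
  - by move=> j; apply: measurableD; exact: measurable_le_rv.
  - move=> j; apply: null_setD => //; try exact: measurable_le_rv.
    have v01 : 0 <= v j <= 1.
      by rewrite -(lee_fin 0) -(lee_fin _ 1) finU cdf_ge0 cdf_le1.
    by rewrite -!cdfE (cdf_prob_transform (onto j) v01) finU.
  - exact: measurableD.
  - move=> w [Vw /existsNP[j Uw]]; exists j => //.
    by split => //; exact: Vw.
have -> : P (below V v) = (P (below V v `\` below U x) + P (below U x))%E.
  by rewrite (measureDI P mV mU) setIidr.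
by rewrite null add0e.
Qed.
End conditional_law.

(** * Right truncation of a copula *)

Definition set_coord (R : realType) (d : nat) (t : 'I_d -> R) (j : 'I_d)
    (x : R) : 'I_d -> R :=
  fun k => if k == j then x else t k.

Section truncation.
Context (R : realType) (d : nat) (C : ('I_d -> R) -> R) (t : 'I_d -> R).
Hypothesis t01 : unit_cube t.

Section law.
Context (disp : measure_display) (T : measurableType disp).
Context (P : probability T R) (U : 'I_d -> {RV P >-> R}).
Hypothesis UC : has_copula_law U C.

Lemma cond_prob_below (x : 'I_d -> R) : (forall j, 0 <= x j <= t j) ->
  cond_prob P (below U x) (below U t) = C x / C t.
Proof.
move=> xt; have [_ PE] := UC.
rewrite /cond_prob setIidl; last first.
  by move=> w Ux j; apply: le_trans (Ux j) _; case/andP: (xt j).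
rewrite !PE// => j; have /andP[x0 xtj] := xt j.
by rewrite x0 (le_trans xtj)//; case/andP: (t01 j).
Qed.

Lemma cond_prob_margin (j : 'I_d) (x : R) : 0 <= x <= t j ->
  cond_prob P [set w | U j w <= x] (below U t) = C (set_coord t j x) / C t.
Proof.
move=> /andP[x0 xt].
have tx k : 0 <= set_coord t j x k <= t k.
  rewrite /set_coord; case: eqP => [->|_]; first by rewrite x0.
  by rewrite lexx andbT; case/andP: (t01 k).
rewrite -cond_prob_below// /cond_prob; congr (fine (P _) / _).
apply/seteqP; split => w /=.
  move=> [Ux Ut]; split => // k.
  by rewrite /set_coord; case: eqP => [->|_]; [exact: Ux|exact: Ut].
by move=> [Ux Ut]; split => //; have := Ux j; rewrite /set_coord eqxx.
Qed.

End law.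

Hypothesis Ct : 0 < C t.

(** [C (set_coord t j x) / C t] is the conditional distribution function of the
    [j]-th coordinate at [x <= t_j].  That it attains every level gives the
    existence of a copula of the conditional law, and evaluating the defining
    identity of any such copula at the quantiles [y_j] of the levels [u_j]
    determines its value at [u]. *)
Lemma right_truncated_copulaE (u y : 'I_d -> R) : is_copula C ->
  (forall j v, 0 <= v <= 1 ->
    exists2 x, 0 <= x <= t j & C (set_coord t j x) = v * C t) ->
  (forall j, 0 <= y j <= t j /\ C (set_coord t j (y j)) = u j * C t) ->
  right_truncated_copula C t u = C y / C t.
Proof.
move=> [disp [T [P [U UC]]]] onto yE.
have exK : exists K, is_right_truncated_copula C t K.
  (* Sklar's theorem is applied under the conditional probability Q. *)
  have mt := measurable_below U t.
  have Pt : (0 < P (below U t))%E by case: UC => _ ->; rewrite ?lte_fin.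
  have [Q QE] := conditional_probability mt Pt.
  pose V j : {RV Q >-> R} := U j.
  have cdfV j x : cdf (V j) x = (cond_prob P [set w | U j w <= x] (below U t))%:E.
    by rewrite cdfE QE//; exact: measurable_le_rv.
  have [j v v01|K [Kcop KE]] := @sklar_onto_margins _ _ _ Q d V.
    have [x xt xE] := onto j v v01.
    exists x; rewrite cdfV (cond_prob_margin UC)// xE mulfK//.
    by rewrite gt_eqF.
  exists K, disp, T, P, U; split => //; split => // x.
  apply: EFin_inj; rewrite -QE; last exact: measurable_below.
  rewrite (KE x); congr (K _)%:E; apply/funext => j.
  by rewrite cdfV.
have [disp' [T' [P' [U' [UC' [_ KE]]]]]] := xgetPex (fun=> 0) exK.
rewrite -(cond_prob_below UC'); last by move=> j; case: (yE j).
rewrite KE; congr (xget _ _ _); apply/funext => j.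
have [yt yj] := yE j.
by rewrite (cond_prob_margin UC')// yj mulfK// gt_eqF.
Qed.

End truncation.

(** * Strict generators and their inverses *)

Section strict_generators.
Context (R : realType).
Implicit Types (psi : R -> R) (x v : R) (y : \bar R).

(** A strict Archimedean generator, seen as a decreasing bijection from
    [0,+oo) onto (0,1].  Surjectivity takes the place of continuity and of
    the limit at infinity: it is the form in which these are used, and it is
    easily transported to rescaled tails. *)
Definition strict_generator psi : Prop :=
  [/\ psi 0 = 1,
      forall x, 0 <= x -> 0 < psi x,
      forall x x', 0 <= x -> x < x' -> psi x' < psi x &
      forall v, 0 < v <= 1 -> exists2 x, 0 <= x & psi x = v].

Lemma generator_inv_ge0 psi v : (0 <= generator_inv psi v)%E.
Proof. by apply: le_ereal_inf_tmp => _ [x [x0 _] <-]; rewrite lee_fin. Qed.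

Lemma strict_generator_lt psi x x' : strict_generator psi ->
  0 <= x -> 0 <= x' -> (psi x' < psi x) = (x < x').
Proof.
move=> [_ _ dec _] x0 x'0; apply/idP/idP; last exact: dec.
apply: contraTT; rewrite -!leNgt le_eqVlt => /predU1P[->//|xx'].
exact/ltW/dec.
Qed.

Lemma strict_generator_le psi x x' : strict_generator psi ->
  0 <= x -> 0 <= x' -> (psi x' <= psi x) = (x <= x').
Proof. by move=> psiS x0 x'0; rewrite leNgt strict_generator_lt// -leNgt. Qed.

Lemma strict_generator_le1 psi x : strict_generator psi ->
  0 <= x -> psi x <= 1.
Proof.
move=> psiS x0; have [<- _ _ _] := psiS.
by rewrite strict_generator_le.
Qed.

Lemma generator_inv_pos0 psi : (forall x, 0 <= x -> 0 < psi x) ->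
  generator_inv psi 0 = +oo%E.
Proof.
move=> pos; rewrite /generator_inv.
rewrite (_ : [set _ | _ in _] = set0) ?ereal_inf0// -subset0.
by move=> z [x [/pos psix_gt0 psix0] _]; rewrite psix0 ltxx in psix_gt0.
Qed.

(** With the value [0] at [+oo], a strict generator is a bijection from
    [0,+oo] onto [0,1]; this lemma and [generator_extK] say that the two
    maps are mutually inverse, so that the level [0] is no special case. *)
Lemma generator_invK psi y : strict_generator psi -> (0 <= y)%E ->
  generator_inv psi (generator_ext psi y) = y.
Proof.
move=> psiS; have [_ pos _ _] := psiS.
case: y => [x|_|//] /=; last exact: generator_inv_pos0.
rewrite /generator_inv lee_fin => x0; rewrite (_ : [set _ | _ in _] = [set x%:E]) ?ereal_inf1//.
apply/seteqP; split => [_ /= [z [z0 zx] <-]|_ ->]; last by exists x.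
congr EFin; apply/le_anti.
by rewrite -(strict_generator_le psiS x0 z0) -(strict_generator_le psiS z0 x0) zx lexx.
Qed.

Lemma generator_invE psi x : strict_generator psi -> 0 <= x ->
  generator_inv psi (psi x) = x%:E.
Proof. by move=> psiS x0; rewrite -(@generator_invK _ x%:E psiS). Qed.

Lemma generator_inv0 psi : strict_generator psi ->
  generator_inv psi 0 = +oo%E.
Proof. by move=> psiS; rewrite -(@generator_invK _ +oo%E psiS). Qed.

Lemma generator_extK psi v : strict_generator psi -> 0 <= v <= 1 ->
  generator_ext psi (generator_inv psi v) = v.
Proof.
move=> psiS /andP[]; rewrite le_eqVlt => /predU1P[<- _|v0 v1].
  by rewrite generator_inv0.
have [_ _ _ /(_ v)[|x x0 <-]] := psiS; first by rewrite v0.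
by rewrite generator_invE.
Qed.

Lemma generator_inv_fine psi v : strict_generator psi -> 0 < v <= 1 ->
  [/\ 0 <= fine (generator_inv psi v), psi (fine (generator_inv psi v)) = v
    & generator_inv psi v = (fine (generator_inv psi v))%:E].
Proof.
move=> psiS v01; have [_ _ _ /(_ v v01)[x x0 <-]] := psiS.
by rewrite generator_invE.
Qed.

Lemma archimedean_fin psi d (u : 'I_d -> R) (a : 'I_d -> R) :
  (forall j, generator_inv psi (u j) = (a j)%:E) ->
  archimedean psi u = psi (\sum_(j < d) a j).
Proof.
by move=> ua; rewrite /archimedean (eq_bigr _ (fun j _ => ua j)) sumEFin.
Qed.

Lemma archimedean_zero psi d (u : 'I_d -> R) (j : 'I_d) :
  strict_generator psi -> u j = 0 -> archimedean psi u = 0.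
Proof.
move=> psiS uj; rewrite /archimedean.
have -> : (\sum_(j < d) generator_inv psi (u j) = +oo)%E => //.
apply/eqP; rewrite esum_eqy; last first.
  by move=> k _; rewrite gt_eqF// (lt_le_trans _ (generator_inv_ge0 _ _)).
by apply/existsP; exists j; rewrite uj generator_inv0//=.
Qed.

Lemma generator_ext_ge0 psi y : strict_generator psi -> (0 <= y)%E ->
  0 <= generator_ext psi y.
Proof.
by move=> [_ pos _ _]; case: y => [x| |]//=; rewrite lee_fin => /pos/ltW.
Qed.

Lemma generator_ext_addr_le psi x y : strict_generator psi -> 0 <= x ->
  (0 <= y)%E -> generator_ext psi (x%:E + y) <= psi x.
Proof.
move=> psiS x0; have [_ pos _ _] := psiS.
case: y => [z|_|//]; last exact/ltW/pos.
rewrite lee_fin /= => z0; rewrite strict_generator_le//; first by rewrite lerDl.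
exact: addr_ge0.
Qed.

End strict_generators.

(** * Truncated Archimedean copulas *)

(** The generator [x |-> psi (s + x) / psi s] of a truncated copula, with its
    argument measured in units of [s].  The change of unit leaves the copula
    unchanged and is the normalization in which regular variation gives a
    limit as [s] grows. *)
Definition tail_generator (R : realType) (psi : R -> R) (s x : R) : R :=
  psi ((1 + x) * s) / psi s.

Section tail_generators.
Context (R : realType) (psi : R -> R).
Hypothesis psiS : strict_generator psi.

Lemma strict_tail_generator s : 0 < s ->
  strict_generator (tail_generator psi s).
Proof.
move=> s0; have [_ pos dec onto] := psiS.
have psis := pos _ (ltW s0).
have onex x : 0 <= x -> 0 <= (1 + x) * s.
  by move=> x0; rewrite mulr_ge0 ?addr_ge0// ltW.
split.
- by rewrite /tail_generator addr0 mul1r divff ?gt_eqF.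
- by move=> x x0; rewrite divr_gt0// pos// onex.
- move=> x x' x0 xx'; rewrite ltr_pM2r ?invr_gt0//; apply: dec; first exact: onex.
  by rewrite ltr_pM2r// ltrD2l.
- move=> v /andP[v0 v1].
  have vs01 : 0 < v * psi s <= 1.
    rewrite mulr_gt0//= -(mulr1 1) ler_pM ?(ltW v0) ?(ltW psis)//.
    by rewrite strict_generator_le1// ltW.
  have [w w0 wE] := onto _ vs01.
  exists (w / s - 1); last first.
    by rewrite /tail_generator subrKC divfK ?gt_eqF// wE mulfK ?gt_eqF.
  rewrite subr_ge0 ler_pdivlMr// mul1r -(strict_generator_le psiS) ?(ltW s0)//.
  by rewrite wE ler_piMl// ltW.
Qed.

Lemma generator_ext_tail s (y : \bar R) : 0 < s -> (0 <= y)%E ->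
  generator_ext psi ((1 + y) * s%:E)%E / psi s =
  generator_ext (tail_generator psi s) y.
Proof.
move=> s0; case: y => [x|_|//] //.
by rewrite addey// gt0_mulye ?lte_fin//= mul0r.
Qed.

(** With [t_j = psi a_j], the conditional quantile of level [v] in coordinate
    [j] is [y_j = psi (a_j + s phi^{-1}[v])], where [phi] is the tail generator.
    Replacing [t_j] by [y_j] increases the argument [s] of [psi] by
    [s phi^{-1}[v]], which multiplies [psi s] by [v]; replacing all coordinates
    gives [psi ((1 + z) s) = psi s * phi z], where [z] is the sum of the
    [phi^{-1}[u_j]].  All of this takes place in [0,+oo], so levels [0] are
    covered. *)
Lemma right_truncated_archimedean d (t u : 'I_d -> R) :
  is_copula (@archimedean R d psi) -> (forall j, 0 < t j <= 1) -> unit_cube u ->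
  let s := \sum_(j < d) fine (generator_inv psi (t j)) in 0 < s ->
  right_truncated_copula (archimedean psi) t u =
  archimedean (tail_generator psi s) u.
Proof.
move=> cop t01 u01 s s0; set phi := tail_generator psi s.
have phiS : strict_generator phi by exact: strict_tail_generator.
have psis : 0 < psi s by case: psiS => _ pos _ _; exact/pos/ltW.
pose a j := fine (generator_inv psi (t j)).
have a0 j : 0 <= a j by case: (generator_inv_fine psiS (t01 j)).
have psia j : psi (a j) = t j by case: (generator_inv_fine psiS (t01 j)).
have aE j : generator_inv psi (t j) = (a j)%:E.
  by case: (generator_inv_fine psiS (t01 j)).
have Ct : archimedean psi t = psi s by exact: archimedean_fin.
pose b v := (generator_inv phi v * s%:E)%E.
have b0 v : (0 <= b v)%E.
  by rewrite mule_ge0 ?generator_inv_ge0// lee_fin ltW.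
pose y j v := generator_ext psi ((a j)%:E + b v)%E.
have yE j v : generator_inv psi (y j v) = ((a j)%:E + b v)%E.
  by rewrite generator_invK// adde_ge0// lee_fin.
have yt j v : 0 <= y j v <= t j.
  rewrite generator_ext_ge0 ?adde_ge0 ?lee_fin//=.
  by rewrite -psia generator_ext_addr_le.
have yC j v : 0 <= v <= 1 ->
    archimedean psi (set_coord t j (y j v)) = v * archimedean psi t.
  move=> v01; rewrite Ct -[X in X * _](generator_extK phiS v01).
  rewrite -generator_ext_tail ?generator_inv_ge0// divfK ?gt_eqF//.
  congr generator_ext.
  rewrite (eq_bigr (fun k => ((a k)%:E + if k == j then b v else 0)%E)); last first.
    move=> k _; rewrite /set_coord; case: eqP => [->|_]; first exact: yE.
    by rewrite aE adde0.
  rewrite big_split /= -big_mkcond big_pred1_eq sumEFin.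
  by rewrite ge0_muleDl ?generator_inv_ge0// mul1e.
rewrite (@right_truncated_copulaE _ _ _ _ _ _ u (fun j => y j (u j)))//.
- rewrite Ct /archimedean -generator_ext_tail ?sume_ge0//; last first.
    by move=> j _; exact: generator_inv_ge0.
  congr (generator_ext _ _ / _).
  rewrite (eq_bigr (fun j => ((a j)%:E + b (u j))%E)); last by move=> j _.
  rewrite big_split /= sumEFin ge0_muleDl ?sume_ge0// ?mul1e; last first.
    by move=> j _; exact: generator_inv_ge0.
  congr (_ + _)%E; rewrite ge0_sume_distrl// => j _.
  exact: generator_inv_ge0.
- by move=> j; case/andP: (t01 j) => /ltW -> ->.
- by rewrite Ct.
- by move=> j v v01; exists (y j v) => //; exact: yC.
- by move=> j; split => //; exact: yC.
Qed.

End tail_generators.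

(** * Strictness of the generators involved *)

Section strictness_criteria.
Context (R : realType).

Lemma strict_archimedean_generator (psi : R -> R) :
  archimedean_generator psi -> (forall x, 0 <= x -> 0 < psi x) ->
  strict_generator psi.
Proof.
move=> [cont [_ [_ [psi0 [to0 dec]]]]] pos; split => //.
  by move=> x x' x0 xx'; apply: dec => //; rewrite generator_inv_pos0// ltry.
move=> v /andP[v0 v1].
have [M [M0 psiM]] : exists M, 0 <= M /\ psi M < v.
  near +oo_R => M; exists M; split; first by near: M; exact: nbhs_pinfty_ge.
  by near: M; exact: cvgr_lt to0 _ v0.
have contM : {within `[0, M], continuous psi}.
  apply: continuous_subspaceW cont => x /=.
  by rewrite !in_itv/= andbT => /andP[].
have [|x] := IVT M0 contM (v := v).
  by rewrite psi0 ge_min le_max v1 (ltW psiM) orbT.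
by rewrite in_itv/= => /andP[x0 _] psix; exists x.
Unshelve. all: by end_near. Qed.

(** A zero of [psi] would make [psi] vanish from there on, so that the quotient
    [psi (1 * t) / psi t] would be [0] eventually and could not tend to [1]. *)
Lemma regularly_varying_gt0 (psi : R -> R) (rho : R) :
  (forall x, 0 <= x -> 0 <= psi x <= 1) ->
  (forall x y, 0 <= x -> x <= y -> psi y <= psi x) ->
  regularly_varying psi rho -> forall x, 0 <= x -> 0 < psi x.
Proof.
move=> psi01 noninc rv x x0.
have /andP[psix0 _] := psi01 x x0.
rewrite lt_neqAle psix0 andbT eq_sym; apply/eqP => psix.
have lim1 := cvgr_gt _ (rv 1 ltr01) 0.
rewrite powR1 in lim1.
near +oo_R => t.
have xt : x <= t by near: t; apply: nbhs_pinfty_ge; exact: num_real.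
have psit : psi t = 0.
  have /andP[psit0 _] := psi01 t (le_trans x0 xt).
  by apply/le_anti; rewrite psit0 andbT -psix; exact: noninc.
suff : 0 < psi (1 * t) / psi t by rewrite psit invr0 mulr0 ltxx.
by near: t; exact: lim1.
Unshelve. all: by end_near. Qed.

Lemma strict_clayton_generator (theta : R) : 0 < theta ->
  strict_generator (clayton_generator theta).
Proof.
move=> th0; rewrite /clayton_generator; split.
- by rewrite addr0 powR1.
- by move=> x x0; rewrite powR_gt0// ltr_wpDr.
- move=> x x' x0 xx'; rewrite !powRN ltf_pV2 ?posrE ?powR_gt0 ?ltr_wpDr//; last first.
    by rewrite (le_trans x0)// ltW.
  apply: gt0_ltr_powR; rewrite ?invr_gt0// ?nnegrE ?addr_ge0// ?ltrD2l//.
  by rewrite (le_trans x0)// ltW.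
- move=> v /andP[v0 v1]; exists (v `^ (- theta) - 1); last first.
    by rewrite subrKC -powRrM mulrNN divff ?gt_eqF// powRr1 ?ltW.
  have : v `^ theta <= 1 `^ theta.
    by apply: ge0_ler_powR; rewrite ?nnegrE// ltW.
  by rewrite powR1 subr_ge0 powRN invf_ge1 ?powR_gt0.
Qed.

End strictness_criteria.

(** * Convergence of generators implies convergence of copulas *)

Section convergence.
Context (R : realType) (T : Type) (F : set_system T) (FF : Filter F).
Context (phi_ : T -> R -> R) (phi : R -> R).
Hypotheses (phi_S : \forall t \near F, strict_generator (phi_ t)).
Hypotheses (phiS : strict_generator phi).
Hypothesis phi_cvg : forall x, 0 <= x -> phi_ t x @[t --> F] --> phi x.

(** If [phi a = v], then [phi (a + e) < v < phi (a - e)]; these two strict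
    inequalities persist along the filter and enclose the inverse of [v] under
    [phi_ t] between [a - e] and [a + e]. *)
Lemma strict_generator_inv_cvg v : 0 < v <= 1 ->
  fine (generator_inv (phi_ t) v) @[t --> F] --> fine (generator_inv phi v).
Proof.
move=> v01; have [a0 phia _] := generator_inv_fine phiS v01.
set a := fine _ in a0 phia *.
apply/cvgrPdist_lt => e e0.
have ae0 : 0 <= a + e by rewrite addr_ge0// ltW.
have upper : \forall t \near F, phi_ t (a + e) < v.
  apply: (cvgr_lt _ (phi_cvg ae0)).
  by rewrite -phia strict_generator_lt// ltrDl.
have lower : \forall t \near F, 0 <= a - e -> v < phi_ t (a - e).
  (* When a - e is negative, inverses exceed it because they are nonnegative. *)
  apply: filter_imply => ae; apply: (cvgr_gt _ (phi_cvg ae)).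
  by rewrite -phia strict_generator_lt// ltrBlDr ltrDl.
near=> t.
have tS : strict_generator (phi_ t) by near: t.
have [b0 phib _] := generator_inv_fine tS v01.
set b := fine _ in b0 phib *.
rewrite distrC ltr_distl; apply/andP; split.
- have [ae|ae] := ltP (a - e) 0; first exact: lt_le_trans ae b0.
  by rewrite -(strict_generator_lt tS)// phib; move: ae; near: t.
- by rewrite -(strict_generator_lt tS)// phib; near: t.
Unshelve. all: by end_near. Qed.

(** Monotonicity makes pointwise convergence enough: [phi_ t (b_ t)] is squeezed
    between the values of [phi_ t] at two fixed points [x2] and [x1] around [b],
    chosen so that [phi] there is within [e] of [phi b]. *)
Lemma strict_generator_cvg_comp (b_ : T -> R) (b : R) :
  (\forall t \near F, 0 <= b_ t) -> 0 <= b -> b_ t @[t --> F] --> b ->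
  phi_ t (b_ t) @[t --> F] --> phi b.
Proof.
move=> b_0 b0 bcvg; apply/cvgrPdist_lt => e e0.
have [phi0 pos _ onto] := phiS.
have phib0 := pos b b0.
(* When [phi b = 1] nothing lies to the left of b within the domain, and the
   point 0 bounds b_ t from below. *)
have [x1 [x10 x1e x1b]] : exists x1,
    [/\ 0 <= x1, phi x1 < phi b + e & x1 < b \/ x1 = 0].
  have [lt1|ge1] := ltP (phi b) 1; last first.
    by exists 0; split; [|rewrite phi0 (le_lt_trans ge1)// ltrDl|right].
  pose v := Num.min 1 (phi b + e / 2).
  have bv : phi b < v by rewrite lt_min lt1 ltrDl divr_gt0.
  have [x1 x10 x1v] : exists2 x, 0 <= x & phi x = v.
    by apply: onto; rewrite (lt_trans phib0 bv) ge_min lexx.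
  exists x1; split => //.
    by rewrite x1v gt_min ltrD2l ltr_pdivrMr// ltr_pMr// ltr1n orbT.
  by left; rewrite -(strict_generator_lt phiS)// x1v.
(* The level [phi b / 2] keeps the sought value positive when e is large. *)
have [x2 [x20 x2e x2b]] : exists x2, [/\ 0 <= x2, phi b - e < phi x2 & b < x2].
  pose v := Num.max (phi b / 2) (phi b - e / 2).
  have vb : v < phi b.
    by rewrite gt_max ltr_pdivrMr// ltr_pMr// ltr1n gtrBl divr_gt0.
  have v0 : 0 < v by rewrite lt_max divr_gt0.
  have [x2 x20 x2v] : exists2 x, 0 <= x & phi x = v.
    apply: onto; rewrite v0 (le_trans (ltW vb))//.
    exact: strict_generator_le1.
  exists x2; split => //.
    by rewrite x2v lt_max ltrD2l ltrN2 ltr_pdivrMr// ltr_pMr// ltr1n orbT.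
  by rewrite -(strict_generator_lt phiS)// x2v.
have x1b_ : \forall t \near F, x1 <= b_ t.
  case: x1b => [x1b|->//]; near=> t; apply: ltW; near: t.
  exact: cvgr_gt bcvg _ x1b.
near=> t.
have tS : strict_generator (phi_ t) by near: t.
have bt0 : 0 <= b_ t by near: t.
rewrite distrC ltr_distl; apply/andP; split.
- apply: (@lt_le_trans _ _ (phi_ t x2)).
    by near: t; exact: cvgr_gt (phi_cvg x20) _ x2e.
  rewrite strict_generator_le//; apply: ltW.
  by near: t; exact: cvgr_lt bcvg _ x2b.
- apply: (@le_lt_trans _ _ (phi_ t x1)); last first.
    by near: t; exact: cvgr_lt (phi_cvg x10) _ x1e.
  by rewrite strict_generator_le//; near: t.
Unshelve. all: by end_near. Qed.

(** A vanishing coordinate makes both copulas vanish.  Otherwise the inverses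
    converge, hence so does their sum, at which the generator is evaluated. *)
Lemma archimedean_cvg d (u : 'I_d -> R) : unit_cube u ->
  archimedean (phi_ t) u @[t --> F] --> archimedean phi u.
Proof.
move=> u01.
have [[j uj]|upos] := pselect (exists j, u j = 0).
  rewrite (archimedean_zero phiS uj); apply: cvg_near_cst.
  by near=> t; apply: archimedean_zero uj; near: t.
have u0 j : 0 < u j <= 1.
  have /andP[uj0 ->] := u01 j; rewrite andbT lt_neqAle uj0 andbT eq_sym.
  by apply/eqP => uj; apply: upos; exists j.
have arch g : strict_generator g ->
    archimedean g u = g (\sum_(j < d) fine (generator_inv g (u j))).
  by move=> gS; apply: archimedean_fin => j; case: (generator_inv_fine gS (u0 j)).
have sum0 g : strict_generator g ->
    0 <= \sum_(j < d) fine (generator_inv g (u j)).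
  by move=> gS; apply: sumr_ge0 => j _; case: (generator_inv_fine gS (u0 j)).
rewrite arch//; apply: cvg_trans.
  apply: (near_eq_cvg (f :=
    fun t => phi_ t (\sum_(j < d) fine (generator_inv (phi_ t) (u j))))).
  by near=> t; rewrite arch//; near: t.
apply: strict_generator_cvg_comp; [|exact: sum0|].
  by near=> t; apply: sum0; near: t.
apply: cvg_big => [|j _]; first exact: add_continuous.
exact: strict_generator_inv_cvg.
Unshelve. all: by end_near. Qed.

End convergence.

(** * Convergence to the Clayton copula *)

(** All the summands are nonnegative, and the [j]-th one exceeds [M] as soon as
    [t_j < psi M]. *)
Lemma sum_generator_inv_cvgy (R : realType) (d : nat) (psi : R -> R)
    (F : set_system ('I_d -> R)) (FF : Filter F) (j : 'I_d) :
  strict_generator psi ->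
  (\forall t \near F, forall k, 0 < t k <= 1) ->
  t j @[t --> F] --> 0^'+ ->
  \sum_(k < d) fine (generator_inv psi (t k)) @[t --> F] --> +oo.
Proof.
move=> psiS t01 tj0; apply/cvgryPge => M.
(* psi is only controlled on the nonnegative reals, hence the truncation of M. *)
pose M' := Num.max M 0.
have M'0 : 0 <= M' by rewrite le_max lexx orbT.
have [_ pos _ _] := psiS.
have tj_lt : \forall t \near F, t j < psi M'.
  exact: (tj0 _ (nbhs_right_lt (pos _ M'0))).
near=> t.
have tk k : 0 < t k <= 1 by move: k; near: t.
have a0 k : 0 <= fine (generator_inv psi (t k)).
  by case: (generator_inv_fine psiS (tk k)).
rewrite (bigD1 j)//= ler_wpDr ?sumr_ge0// (@le_trans _ _ M')//.
  by rewrite le_max lexx.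
rewrite -(strict_generator_le psiS)//.
have [_ -> _] := generator_inv_fine psiS (tk j).
by apply: ltW; near: t.
Unshelve. all: by end_near. Qed.

(* The limit "t_j decreases to 0 for at least one j" is taken along an arbitrary
   filter F on t (hence along every sequence or net): eventually t is in
   (0,1]^d with C t > 0, and some coordinate t_j tends to 0 from the right,
   with no condition on the other coordinates. *)
Theorem mainTheorem6 (R : realType) (d : nat) (psi : R -> R) (theta : R)
    (theta_gt0 : 0 < theta)
    (psi_gen : generators d psi)
    (psi_rv : regularly_varying psi (- theta^-1))
    (F : set_system ('I_d -> R)) (FF : Filter F)
    (F_dom : \forall t \near F,
       (forall j, 0 < t j <= 1) /\ 0 < archimedean psi t)
    (F_to0 : exists j, t j @[t --> F] --> 0^'+)
    (u : 'I_d -> R) (hu : unit_cube u) :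
  right_truncated_copula (archimedean psi) t u @[t --> F]
    --> archimedean (clayton_generator theta) u.
Proof.
have [genA cop] := psi_gen.
have psiS : strict_generator psi.
  apply: strict_archimedean_generator => //.
  have [_ [psi01 [noninc _]]] := genA.
  exact: regularly_varying_gt0 psi_rv.
have claytonS := strict_clayton_generator theta_gt0.
have t01 : \forall t \near F, forall j, 0 < t j <= 1.
  by apply: filterS F_dom => t [].
have [j tj0] := F_to0.
pose s (t : 'I_d -> R) := \sum_(k < d) fine (generator_inv psi (t k)).
have sy : s t @[t --> F] --> +oo by exact: sum_generator_inv_cvgy tj0.
have s0 : \forall t \near F, 0 < s t by move/cvgryPgt : sy; exact.
apply: cvg_trans.
  apply: (near_eq_cvg (f := fun t => archimedean (tail_generator psi (s t)) u)).
  near=> t; rewrite right_truncated_archimedean//; first by near: t.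
  by near: t.
apply: archimedean_cvg => //.
  by near=> t; apply: strict_tail_generator => //; near: t.
move=> x x0.
have tail_cvg : tail_generator psi r x @[r --> +oo] --> clayton_generator theta x.
  by apply: psi_rv; rewrite ltr_wpDr.
exact: cvg_comp sy tail_cvg.
Unshelve. all: by end_near. Qed.
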